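(* Fix an integer $n\ge 2$ and let $\mathcal{A}\in\mathcal{H}(s_{i,j})$ be a complete hypertetrahedral arrangement in $\mathbb{P}^n$. Let $D:=\max_{0\le i_0<q_0\le n}\{M^{i_0,q_0}\}$. Then for all $1\le d\le D$, $$\mathrm{Der}(-\log\mathcal{A})_d\subset R_{d-1}\,\theta_E .$$
   Context: $\Bbbk$ is an algebraically closed field of characteristic $0$, $R=\Bbbk[x_0,\dots,x_n]$, $\mathbb{P}^n=\mathrm{Proj}(R)$. For a hyperplane arrangement $\mathcal{A}$ (finite set of distinct hyperplanes in $\mathbb{P}^n$) with $f_{\mathcal{A}}$ the product of linear forms defining its hyperplanes, $\mathrm{Der}(-\log\mathcal{A})=\{\theta\in \mathrm{Der}_{\Bbbk}(R): \theta(f_{\mathcal{A}})\in (f_{\mathcal{A}})\}$; $\mathrm{Der}(-\log\mathcal{A})_d$ is the set of such $\theta=\sum_i\theta_i\partial_{x_i}$ with all $\theta_i\in R_d$ homogeneous of degree $d$. $\theta_E=\sum_i x_i\partial_{x_i}$ is the Euler derivation. For $0\le i<j\le n$ let $\mathcal{L}_{i,j}=\{x_i=x_j=0\}$. A hypertetrahedral arrangement in $\mathbb{P}^n$ is one in which every hyperplane contains some $\mathcal{L}_{i,j}$; it is complete if it contains all coordinate hyperplanes $\{x_i=0\}$, $0\le i\le n$. For integers $s_{i,j}\ge 1$ ($0\le i<j\le n$), $\mathcal{H}(s_{i,j})$ is the set of complete hypertetrahedral arrangements with exactly $s_{i,j}+2$ hyperplanes through $\mathcal{L}_{i,j}$ for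 all $i<j$. The convention $s_{j,i}=s_{i,j}$ is used. For $0\le i_0<q_0\le n$, let $T^{i_0,q_0}$ be the set of all $(n-1)$-tuples $v=((i_0,j_0,q_0),(i_1,j_1,q_1),\dots,(i_{n-2},j_{n-2},q_{n-2}))$ of triples of integers with $0\le i_m,j_m,q_m\le n$ such that $j_0\notin\{i_0,q_0\}$ and, for each $1\le m\le n-2$: (i) $j_m\notin\{i_0,\dots,i_{m-1},j_0,\dots,j_{m-1},q_0,\dots,q_{m-1}\}$; (ii) $i_m<q_m$ and $i_m,q_m\in\{i_0,\dots,i_{m-1},j_0,\dots,j_{m-1},q_0,\dots,q_{m-1}\}$. For $v\in T^{i_0,q_0}$ set $$S_v^{i_0,q_0}=\{s_{i_0,q_0},\,s_{i_0,j_0}+s_{j_0,q_0},\,s_{i_1,j_1}+s_{j_1,q_1},\dots,s_{i_{n-2},j_{n-2}}+s_{j_{n-2},q_{n-2}}\},$$ $m_v^{i_0,q_0}=\min S_v^{i_0,q_0}$, and $M^{i_0,q_0}=\max_{v\in T^{i_0,q_0}} m_v^{i_0,q_0}$. *)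

(* Defs.v *)
From mathcomp Require Import all_boot all_order all_algebra.
From mathcomp Require Export mpoly.

Set Implicit Arguments.
Unset Strict Implicit.
Unset Printing Implicit Defensive.

Import GRing.Theory.
Local Open Scope ring_scope.

(* The ring R = k[x_0, ..., x_n] is {mpoly k[n.+1]}.  A linear form is given by
   the row of its coefficients, and linear subspaces of P^n (hyperplanes and
   the L_{i,j}) by the corresponding vector subspaces of k^(n+1). *)

Section Arrangements.

Variables (k : fieldType) (n : nat).
Implicit Types (c : 'rV[k]_n.+1) (A : seq 'rV[k]_n.+1).

Definition linear_form c : {mpoly k[n.+1]} := \sum_i c 0 i *: 'X_i.

Definition hyperplane c : {vspace 'rV[k]_n.+1} := lker (linfun (mulmxr c^T)).

Lemma mem_hyperplane c x :
  (x \in hyperplane c) = ((linear_form c).@[x 0] == 0).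
Proof.
have -> : (linear_form c).@[x 0] = (x *m c^T) 0 0.
  rewrite /linear_form raddf_sum mxE; apply: eq_bigr => i _ /=.
  by rewrite mevalZ mevalXU mxE mulrC.
rewrite memv_ker lfunE /=; apply/eqP/eqP => [->|e]; first by rewrite mxE.
by apply/matrixP => i j; rewrite !ord1 e mxE.
Qed.

(* An arrangement is listed by one defining linear form per hyperplane. *)
Definition is_arrangement A : bool :=
  (0 \notin A) && uniq [seq hyperplane c | c <- A].

Definition defining_poly A : {mpoly k[n.+1]} := \prod_(c <- A) linear_form c.

Definition coord_hyperplane (i : 'I_n.+1) : {vspace 'rV[k]_n.+1} :=
  hyperplane (delta_mx 0 i).

Definition coord_codim2 (i j : 'I_n.+1) : {vspace 'rV[k]_n.+1} :=
  (coord_hyperplane i :&: coord_hyperplane j)%VS.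

Definition hypertetrahedral A : Prop :=
  is_arrangement A /\
  forall c, c \in A ->
    exists i j : 'I_n.+1, (i < j)%N /\ (coord_codim2 i j <= hyperplane c)%VS.

Definition complete A : Prop :=
  forall i : 'I_n.+1, coord_hyperplane i \in [seq hyperplane c | c <- A].

Definition complete_hypertetrahedral (s : 'I_n.+1 -> 'I_n.+1 -> nat) A : Prop :=
  [/\ hypertetrahedral A, complete A &
      forall i j : 'I_n.+1, (i < j)%N ->
        count (fun c => (coord_codim2 i j <= hyperplane c)%VS) A
          = (s i j + 2)%N].

End Arrangements.

Section Derivations.

Variables (k : fieldType) (n : nat).
Local Notation R := {mpoly k[n.+1]}.

Definition derivation (theta : R -> R) : Prop :=
  linear theta /\ forall p q, theta (p * q) = theta p * q + p * theta q.

Definition log_derivation (A : seq 'rV[k]_n.+1) (theta : R -> R) : Prop :=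
  derivation theta /\
  exists g : R, theta (defining_poly A) = g * defining_poly A.

(* The zero polynomial is d-homogeneous for every d *)
Definition log_derivation_deg (A : seq 'rV[k]_n.+1) (d : nat)
    (theta : R -> R) : Prop :=
  log_derivation A theta /\
  exists t : 'I_n.+1 -> R, (forall i, t i \is d.-homog) /\
    forall p, theta p = \sum_i t i * p^`M(i).

Definition euler (p : R) : R := \sum_i 'X_i * p^`M(i).

End Derivations.

Section Bound.

Variable n : nat.
Local Notation triple := ('I_n.+1 * 'I_n.+1 * 'I_n.+1)%type.
Implicit Types (t : triple) (v : (n.-1).-tuple triple).

Definition ti t : 'I_n.+1 := t.1.1.
Definition tj t : 'I_n.+1 := t.1.2.
Definition tq t : 'I_n.+1 := t.2.

Definition indices (w : seq triple) : seq 'I_n.+1 :=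
  flatten [seq [:: ti t; tj t; tq t] | t <- w].

Definition T (i0 q0 : 'I_n.+1) : {set (n.-1).-tuple triple} :=
  [set v : (n.-1).-tuple triple | [forall m : 'I_(n.-1),
     let: (im, jm, qm) := tnth v m in
     if m == 0%N :> nat then
       [&& im == i0, qm == q0 & jm \notin [:: i0; q0]]
     else
       let previous := indices (take m v) in
       [&& jm \notin previous, (im < qm)%N,
           im \in previous & qm \in previous]]].

Variable s : 'I_n.+1 -> 'I_n.+1 -> nat.

(* The minimum of S_v^{i0,q0}; its element s_{i0,q0} is the starting value. *)
Definition m_min (i0 q0 : 'I_n.+1) v : nat :=
  \big[minn/s i0 q0]_(t <- v) (s (ti t) (tj t) + s (tj t) (tq t))%N.

(* T i0 q0 is nonempty when i0 < q0 and n >= 2, so the default value 0 of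
   \max is immaterial here and in D_max. *)
Definition M_max (i0 q0 : 'I_n.+1) : nat :=
  (\max_(v in T i0 q0) m_min i0 q0 v)%N.

Definition D_max : nat :=
  (\max_(i0 < n.+1) \max_(q0 < n.+1 | i0 < q0) M_max i0 q0)%N.

End Bound.

(* Main.v *)
(* A logarithmic derivation satisfies l | theta(l) for every form l of the
   arrangement, so theta(x_i) = x_i h_i, and every form a x_i + b x_j with a and b
   nonzero divides h_i - h_j.  The s_{i,j} such forms are pairwise coprime, so
   h_i = h_j as soon as deg h_i = d - 1 < s_{i,j}.  If h_i = h_q, the forms
   through L_{i,j} and those through L_{j,q} all divide h_i - h_j, so that
   d - 1 < s_{i,j} + s_{j,q} suffices for h_j = h_i.  Following a tuple v that
   attains D makes all the h_i equal. *)
Require Import Defs.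
From mathcomp Require Import all_boot all_order all_algebra mpoly.
Import GRing.Theory.
Local Open Scope ring_scope.

(** * Divisibility in commutative rings *)

Definition divides {R : comNzRingType} (a b : R) : Prop := exists q, b = q * a.

Section Divides.

Local Set Implicit Arguments.
Local Unset Strict Implicit.

Variable R : comNzRingType.
Implicit Types a b c : R.

Lemma divides_refl a : divides a a.
Proof. by exists 1; rewrite mul1r. Qed.

Lemma dividesD a b c : divides a b -> divides a c -> divides a (b + c).
Proof. by move=> [u ->] [v ->]; exists (u + v); rewrite mulrDl. Qed.

Lemma dividesB a b c : divides a b -> divides a c -> divides a (b - c).
Proof. by move=> [u ->] [v ->]; exists (u - v); rewrite mulrBl. Qed.

Lemma dividesMl a b c : divides a c -> divides a (b * c).
Proof. by move=> [u ->]; exists (b * u); rewrite mulrA. Qed.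

Lemma dividesMr a b c : divides a b -> divides a (b * c).
Proof. by move=> ab; rewrite mulrC; apply: dividesMl. Qed.

Lemma divides_sum a (I : Type) (r : seq I) (F : I -> R) :
  (forall i, divides a (F i)) -> divides a (\sum_(i <- r) F i).
Proof.
move=> aF; elim/big_ind: _ => // [|b c]; last exact: dividesD.
by exists 0; rewrite mul0r.
Qed.

(** Congruences modulo [a] multiply; this carries a congruence from variables to monomials. *)
Lemma divides_subM a b b' c c' :
  divides a (b - b') -> divides a (c - c') -> divides a (b * c - b' * c').
Proof.
move=> ab ac; have -> : b * c - b' * c' = (b - b') * c + b' * (c - c').
  by rewrite mulrBl mulrBr addrA subrK.
by apply: dividesD; [apply: dividesMr | apply: dividesMl].
Qed.

End Divides.

(** * Linear forms, their hyperplanes, and products of distinct forms *)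

Section LinearForms.

Local Set Implicit Arguments.
Local Unset Strict Implicit.

Variables (k : fieldType) (n : nat).
Local Notation R := {mpoly k[n.+1]}.
Implicit Types (c : 'rV[k]_n.+1) (p q : R).

Lemma linear_formZ a c : linear_form (a *: c) = a *: linear_form c.
Proof.
by rewrite /linear_form scaler_sumr; apply: eq_bigr => i _; rewrite mxE scalerA.
Qed.

Lemma linear_form_delta i : linear_form (delta_mx 0 i : 'rV[k]_n.+1) = 'X_i.
Proof.
rewrite /linear_form (bigD1 i) //= big1 => [|j /negbTE ji]; last first.
  by rewrite mxE ji andbF scale0r.
by rewrite mxE !eqxx scale1r addr0.
Qed.

Lemma mcoeff_linear_form c i : (linear_form c)@_U_(i) = c 0 i.
Proof.
rewrite /linear_form raddf_sum (bigD1 i) //= big1 => [|j /negbTE ji].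
  by rewrite mcoeffZ mcoeffXU eqxx mulr1 addr0.
by rewrite mcoeffZ mcoeffXU ji mulr0.
Qed.

Lemma linear_form_eq0 c : (linear_form c == 0) = (c == 0).
Proof.
apply/eqP/eqP => [c0|->]; last first.
  by rewrite /linear_form big1 // => i _; rewrite mxE scale0r.
by apply/rowP => i; rewrite -mcoeff_linear_form c0 mcoeff0 mxE.
Qed.

Lemma linear_form_homog c : linear_form c \is 1.-homog.
Proof.
by apply: rpred_sum => i _; apply: rpredZ; rewrite dhomogX /= mdeg1.
Qed.

Lemma row_neq0P c : reflect (exists i, c 0 i != 0) (c != 0).
Proof.
apply: (iffP idP) => [c0|[i]]; last by apply: contra_neq => ->; rewrite mxE.
apply/existsP; apply: contraR c0; rewrite negb_exists => /forallP c0.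
by apply/eqP/rowP => i; rewrite mxE; apply/eqP; rewrite -[_ == _]negbK.
Qed.

Lemma mem_hyperplane_sum c (x : 'rV[k]_n.+1) :
  (x \in hyperplane c) = (\sum_i c 0 i * x 0 i == 0).
Proof.
rewrite mem_hyperplane /linear_form raddf_sum /=; congr (_ == 0).
by apply: eq_bigr => i _; rewrite mevalZ mevalXU.
Qed.

(** If [c 0 m] is nonzero, each vector c_m e_i - c_i e_m lies in the hyperplane of [c]; the
    vanishing of [c'] there reads c'_i c_m = c'_m c_i, so the ratio is c'_m / c_m. *)
Lemma hyperplane_subP c c' : c != 0 -> (hyperplane c <= hyperplane c')%VS ->
  exists a, c' = a *: c.
Proof.
case/row_neq0P => m cm cc'; exists (c' 0 m / c 0 m).
apply/rowP => i; rewrite mxE.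
pose x : 'rV[k]_n.+1 := c 0 m *: delta_mx 0 i - c 0 i *: delta_mx 0 m.
have evx (b : 'rV[k]_n.+1) :
    \sum_j b 0 j * x 0 j = b 0 i * c 0 m - b 0 m * c 0 i.
  have dlt l : \sum_j b 0 j * (delta_mx 0 l : 'rV[k]_n.+1) 0 j = b 0 l.
    rewrite (bigD1 l) //= big1 => [|j /negbTE jl]; last first.
      by rewrite mxE jl andbF mulr0.
    by rewrite mxE !eqxx mulr1 addr0.
  under eq_bigr do rewrite !mxE mulrBr.
  rewrite sumrB -(dlt i) -(dlt m) !mulr_suml.
  by congr (_ - _); apply: eq_bigr => j _; rewrite !mxE mulrA mulrAC.
have : x \in hyperplane c'.
  by rewrite (subvP cc') // mem_hyperplane_sum evx mulrC subrr.
rewrite mem_hyperplane_sum evx subr_eq0 => /eqP e.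
by rewrite mulrAC -e mulfK.
Qed.

Lemma divides_linear_form c c' : divides (linear_form c) (linear_form c') ->
  (hyperplane c <= hyperplane c')%VS.
Proof.
move=> [q e]; apply/subvP => x; rewrite !mem_hyperplane e mevalM => /eqP ->.
by rewrite mulr0.
Qed.

Lemma hyperplane_scale a c : a != 0 -> hyperplane (a *: c) = hyperplane c.
Proof.
move=> a0; apply/vspaceP => x; rewrite !mem_hyperplane linear_formZ mevalZ.
by rewrite mulf_eq0 (negbTE a0).
Qed.

Lemma hyperplane_sub_eq c c' : c != 0 -> c' != 0 ->
  (hyperplane c <= hyperplane c')%VS -> hyperplane c = hyperplane c'.
Proof.
move=> c0 c'0 /(hyperplane_subP c0)[a e]; rewrite e hyperplane_scale//.
by apply: contra_neq c'0 => a0; rewrite e a0 scale0r.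
Qed.

(* The substitution X_m := X_m - l/c_m is congruent to the identity modulo the
   form l of c and kills l, so l divides p exactly when the substitution kills
   p; the target is an integral domain. *)
Lemma linear_form_prime c p q : c != 0 -> divides (linear_form c) (p * q) ->
  divides (linear_form c) p \/ divides (linear_form c) q.
Proof.
case/row_neq0P => m cm; set l := linear_form c.
pose t : n.+1.-tuple R :=
  [tuple 'X_i - (if i == m then (c 0 m)^-1 *: l else 0) | i < n.+1].
have tE i : 'X_i \mPo t = 'X_i - (if i == m then (c 0 m)^-1 *: l else 0).
  by rewrite comp_mpolyXU -tnth_nth tnth_mktuple.
have tl : l \mPo t = 0.
  rewrite {1}/l /linear_form raddf_sum /=.
  under eq_bigr do rewrite comp_mpolyZ tE scalerBr.
  rewrite sumrB (bigD1 m) //= [X in _ - X](bigD1 m) //= eqxx.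
  rewrite [X in _ - (_ + X)]big1 => [|i /negbTE->]; last by rewrite scaler0.
  by rewrite addr0 scalerA mulfV // scale1r /l /linear_form [X in _ - X](bigD1 m) //= subrr.
(* The congruence is checked on variables, then on monomials by multiplicativity, then on all
   polynomials by linearity. *)
have id_mod r : divides l (r - (r \mPo t)).
  have lX i : divides l ('X_i - ('X_i \mPo t)).
    rewrite tE subKr; case: eqP => _; last by exists 0; rewrite mul0r.
    by rewrite -mul_mpolyC; apply: dividesMl; apply: divides_refl.
  have lM (mm : 'X_{1..n.+1}) : divides l ('X_[mm] - ('X_[mm] \mPo t)).
    rewrite mpolyXE_id rmorph_prod /=.
    apply: (big_ind2 (fun a b => divides l (a - b))) => [|*|i _].
    - by rewrite subrr; exists 0; rewrite mul0r.
    - exact: divides_subM.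
    rewrite rmorphXn /=; elim: (mm i) => [|e IH].
      by rewrite !expr0 subrr; exists 0; rewrite mul0r.
    by rewrite !exprS; apply: divides_subM.
  rewrite comp_mpolyEX [X in X - _]mpolyE -sumrB; apply: divides_sum => mm.
  by rewrite -scalerBr -mul_mpolyC; apply: dividesMl.
have t0 r : r \mPo t = 0 -> divides l r.
  by move=> r0; have := id_mod r; rewrite r0 subr0.
move=> [u e]; have /eqP : (p * q) \mPo t = 0 by rewrite e rmorphM /= tl mulr0.
by rewrite rmorphM mulf_eq0 => /orP[] /eqP /t0; [left | right].
Qed.

(** Since the form of [c] is prime, it divides one of the factors, and a nonzero linear form
    divisible by it has the same hyperplane. *)
Lemma divides_defining_poly (B : seq 'rV[k]_n.+1) c :
  c != 0 -> divides (linear_form c) (defining_poly B) -> 0 \notin B ->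
  hyperplane c \in [seq hyperplane b | b <- B].
Proof.
move=> c0; elim: B => [|b B IH].
  rewrite /defining_poly big_nil => -[q e].
  (* Evaluation at the origin, where linear forms vanish, turns 1 = q l into 1 = 0. *)
  have /(congr1 (fun r : R => r.@[fun=> 0])) := e.
  rewrite rmorph1 rmorphM /= => /eqP; rewrite /linear_form raddf_sum /=.
  rewrite [X in _ * X]big1 ?mulr0 ?oner_eq0 // => j _.
  by rewrite mevalZ mevalXU mulr0.
rewrite /defining_poly big_cons in_cons negb_or => + /andP[b0 B0].
case/(linear_form_prime c0) => [/divides_linear_form cb|/IH/(_ B0) cB]; last first.
  by rewrite in_cons cB orbT.
by rewrite in_cons (hyperplane_sub_eq c0 _ cb) ?eqxx // eq_sym.
Qed.

(** Induction on the list: if [p] is [q] times the product of the tail, the prime form of [b]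
    divides [q] or that product, and the latter would repeat a hyperplane. *)
Lemma defining_poly_divides (B : seq 'rV[k]_n.+1) p : is_arrangement B ->
  (forall c, c \in B -> divides (linear_form c) p) ->
  divides (defining_poly B) p.
Proof.
rewrite /is_arrangement /defining_poly.
elim: B => [|b B IH]; first by exists p; rewrite big_nil mulr1.
rewrite in_cons negb_or /= eq_sym => /andP[/andP[b0 B0] /andP[bB uB]] Bp.
have [|c cB|q e] := IH; first by rewrite B0.
  by apply: Bp; rewrite in_cons cB orbT.
have := Bp b (mem_head _ _); rewrite e => /(linear_form_prime b0)[[u ->]|].
  by exists u; rewrite big_cons mulrA.
by move/(divides_defining_poly b0) => /(_ B0); rewrite (negbTE bB).
Qed.

Lemma defining_poly_neq0 (B : seq 'rV[k]_n.+1) :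
  0 \notin B -> defining_poly B != 0.
Proof.
move=> B0; rewrite /defining_poly prodf_seq_neq0; apply/allP => c cB /=.
by rewrite linear_form_eq0; apply: contraNneq B0 => <-.
Qed.

Lemma defining_poly_homog (B : seq 'rV[k]_n.+1) :
  defining_poly B \is (size B).-homog.
Proof.
rewrite /defining_poly; elim: B => [|b B IH].
  by rewrite big_nil; apply: dhomog1.
by rewrite big_cons -[size _]/(1 + size B)%N; apply: dhomogM IH; apply: linear_form_homog.
Qed.

Lemma msize_dhomog d p : p != 0 -> p \is d.-homog -> msize p = d.+1.
Proof.
move=> p0 hp; have := dhomog_uniq p0 hp (dhomog_msize hp).
rewrite -[mmeasure _ _]/(msize p) => ->; rewrite prednK //.
by rewrite lt0n msize_poly_eq0.
Qed.

(** The product of all the forms divides [p] and has degree [size B], which exceeds that of [p]. *)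
Lemma dhomog_divides_eq0 (B : seq 'rV[k]_n.+1) d p :
  is_arrangement B -> p \is d.-homog -> (d < size B)%N ->
  (forall c, c \in B -> divides (linear_form c) p) -> p = 0.
Proof.
move=> aB hp dB Bp; apply: contraTeq dB => p0; rewrite -leqNgt.
have [q e] := defining_poly_divides aB Bp.
have B0 : defining_poly B != 0 by apply: defining_poly_neq0; case/andP: aB.
have q0 : q != 0 by apply: contra_neq p0 => q0; rewrite e q0 mul0r.
have := msize_dhomog p0 hp.
rewrite e msizeM // (msize_dhomog B0 (defining_poly_homog B)).
(* As [msize] is the degree plus one, the equation is [msize q + size B = d.+1], and [msize q] is
   positive. *)
by rewrite addnS /= => eq; rewrite -ltnS -eq -addn1 addnC leq_add2r lt0n msize_poly_eq0.
Qed.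

(** Multiplication by ['X_i] shifts the support by U_(i), so no monomial of [p] is lost and each
    gains one degree. *)
Lemma dhomog_MXl d i p : 'X_i * p \is d.+1.-homog -> p \is d.-homog.
Proof.
move=> /dhomogP h; apply/dhomogP => m mp.
have := h (U_(i) + m)%MM; rewrite mcoeff_msupp (mulrC 'X_i) mcoeffMX -mcoeff_msupp mp.
by move=> /(_ isT) /=; rewrite mdegD mdeg1 => -[].
Qed.

End LinearForms.

(** * Logarithmic derivations and the forms through a coordinate subspace of codimension two *)

Section LogDerivations.

Local Set Implicit Arguments.
Local Unset Strict Implicit.

Variables (k : fieldType) (n : nat) (A : seq 'rV[k]_n.+1).
Local Notation R := {mpoly k[n.+1]}.
Implicit Types c : 'rV[k]_n.+1.
Hypothesis arrA : is_arrangement A.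

(** Write the defining polynomial as l f', with l the form of [c]. By the Leibniz rule l divides
    theta(l) f'. It does not divide f', whose hyperplanes all differ from that of l, so it divides
    theta(l). *)
Lemma log_derivation_linear_form (theta : R -> R) c :
  log_derivation A theta -> c \in A ->
  divides (linear_form c) (theta (linear_form c)).
Proof.
move=> [[_ der] [g e]] cA.
have [A0 uA] := andP arrA.
have c0 : c != 0 by apply: contraNneq A0 => <-.
have pe := perm_to_rem cA.
have fE : defining_poly A = linear_form c * defining_poly (rem c A).
  by rewrite /defining_poly (perm_big _ pe) big_cons.
have : divides (linear_form c) (theta (linear_form c) * defining_poly (rem c A)).
  have -> : theta (linear_form c) * defining_poly (rem c A) =
      theta (defining_poly A) - linear_form c * theta (defining_poly (rem c A)).
    by rewrite fE der addrK.
  rewrite e fE; apply: dividesB; last by apply/dividesMr/divides_refl.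
  by apply/dividesMl/dividesMr/divides_refl.
case/(linear_form_prime c0) => // /(divides_defining_poly c0).
rewrite (contra (@mem_rem _ c A 0) A0) => /(_ isT).
have := perm_uniq (perm_map (@hyperplane k n) pe).
by rewrite uA /= => /esym/andP[/negbTE->].
Qed.

(** For distinct [i] and [j], these are the forms through L_{i,j} that are not multiples of ['X_i]
    or ['X_j]. The condition is symmetric in [i] and [j]. *)
Definition supported_on (i j : 'I_n.+1) c : bool :=
  [forall l, (c 0 l != 0) == (l \in [:: i; j])].

Lemma linear_form_supported_on i j c : i != j -> supported_on i j c ->
  linear_form c = c 0 i *: 'X_i + c 0 j *: 'X_j.
Proof.
move=> ij /forallP sc; rewrite /linear_form (bigD1 i) //= (bigD1 j) 1?eq_sym //=.
rewrite big1 ?addr0 // => l /andP[li lj]; have := sc l.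
by rewrite !inE (negbTE li) (negbTE lj) eqbF_neg negbK => /eqP->; rewrite scale0r.
Qed.

Lemma count_hyperplane_le1 (H : {vspace 'rV[k]_n.+1}) :
  (count (fun c => hyperplane c == H) A <= 1)%N.
Proof.
have [_ uA] := andP arrA.
rewrite (_ : count _ A = count_mem H [seq hyperplane c | c <- A]).
  by rewrite count_uniq_mem //; case: (_ \in _).
by rewrite count_map.
Qed.

(** The basis vector e_l lies in L_{i,j}, and the form takes the value [c 0 l] there. *)
Lemma codim2_sub_hyperplane (i j l : 'I_n.+1) c :
  (coord_codim2 k i j <= hyperplane c)%VS -> l \notin [:: i; j] -> c 0 l = 0.
Proof.
rewrite !inE negb_or => sub /andP[li lj].
have : (delta_mx 0 l : 'rV[k]_n.+1) \in hyperplane c.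
  apply: (subvP sub); rewrite memv_cap /coord_hyperplane !mem_hyperplane.
  by rewrite !linear_form_delta !mevalXU !mxE /= ![_ == l]eq_sym (negbTE li) (negbTE lj) eqxx.
rewrite mem_hyperplane_sum (bigD1 l) //= big1 => [|j' /negbTE jl].
  by rewrite mxE !eqxx mulr1 addr0 => /eqP.
by rewrite mxE jl andbF mulr0.
Qed.

Lemma hyperplane_coord (i : 'I_n.+1) c : c != 0 -> (forall l, l != i -> c 0 l = 0) ->
  hyperplane c = coord_hyperplane k i.
Proof.
move=> c0 ci; have e : c = c 0 i *: delta_mx 0 i.
  apply/rowP => l; rewrite !mxE eqxx /=; have [->|li] := eqVneq l i.
    by rewrite mulr1.
  by rewrite mulr0 ci.
rewrite e hyperplane_scale //.
by apply: contra_neq c0 => ci0; rewrite e ci0 scale0r.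
Qed.

(** A form through L_{i,j} involves only ['X_i] and ['X_j]. If one coefficient vanishes, it defines
    a coordinate hyperplane, and each of these two occurs at most once in [A]; hence the 2. *)
Lemma count_supported_on i j :
  (count (fun c => (coord_codim2 k i j <= hyperplane c)%VS) A
     <= count (supported_on i j) A + 2)%N.
Proof.
have [A0 _] := andP arrA.
pose ei c := hyperplane c == coord_hyperplane k i.
pose ej c := hyperplane c == coord_hyperplane k j.
apply: (@leq_trans (count (supported_on i j) A + (count ei A + count ej A))); last first.
  by rewrite leq_add2l; apply: (leq_add (count_hyperplane_le1 _) (count_hyperplane_le1 _)).
apply: (@leq_trans (count (predU (supported_on i j) (predU ei ej)) A)); last first.
  have cU (a b : pred 'rV[k]_n.+1) : (count (predU a b) A <= count a A + count b A)%N.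
    by rewrite -(count_predUI a b) leq_addr.
  by apply: leq_trans (cU _ _) _; rewrite leq_add2l.
(* Membership in [A] is added to the predicate so that [sub_count] can use that [c] is nonzero. *)
rewrite -(@eq_in_count _ (fun c => (c \in A) && (coord_codim2 k i j <= hyperplane c)%VS)); last first.
  by move=> c /= ->.
apply: sub_count => c /andP[cA sub] /=.
have c0 : c != 0 by apply: contraNneq A0 => <-.
have cl := codim2_sub_hyperplane sub.
have [cj0|cj0] := eqVneq (c 0 j) 0.
  apply/orP; right; apply/orP; left; apply/eqP; apply: hyperplane_coord => // l li.
  have [->//|lj] := eqVneq l j; apply: cl.
  by rewrite !inE negb_or li.
have [ci0|ci0] := eqVneq (c 0 i) 0.
  apply/orP; right; apply/orP; right; apply/eqP; apply: hyperplane_coord => // l lj.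
  have [->//|li] := eqVneq l i; apply: cl.
  by rewrite !inE negb_or li.
apply/orP; left; apply/forallP => l; have [lij|/cl->] := boolP (l \in _).
  by move: lij; rewrite !inE => /orP[]/eqP->; rewrite ?ci0 ?cj0.
by rewrite eqxx.
Qed.

Lemma is_arrangement_filter (P : pred 'rV[k]_n.+1) : is_arrangement (filter P A).
Proof.
have [A0 uA] := andP arrA; rewrite /is_arrangement mem_filter negb_and A0 orbT /=.
exact: subseq_uniq (map_subseq _ (filter_subseq P A)) uA.
Qed.

Lemma supported_on_disjoint i j q c : i != q -> i != j ->
  supported_on i j c -> supported_on j q c -> false.
Proof.
move=> iq ij /forallP/(_ i)/eqP cij /forallP/(_ i)/eqP; rewrite cij.
by rewrite !inE eqxx (negbTE iq) (negbTE ij).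
Qed.

(** The two coordinate hyperplanes cancel the 2 in the definition of the arrangement; symmetry of
    [s] and of [supported_on] covers the order [j < i]. *)
Lemma supported_on_count_le (s : 'I_n.+1 -> 'I_n.+1 -> nat) i j :
  (forall i j : 'I_n.+1, s j i = s i j) -> complete_hypertetrahedral s A ->
  i != j -> (s i j <= count (supported_on i j) A)%N.
Proof.
move=> s_sym [_ _ cnt]; have lt_case (a b : 'I_n.+1) : (a < b)%N ->
    (s a b <= count (supported_on a b) A)%N.
  by move=> ab; rewrite -(leq_add2r 2) -cnt //; apply: count_supported_on.
rewrite neq_ltn => /orP[/lt_case //|/lt_case]; rewrite s_sym => /leq_trans-> //.
apply: sub_count => c /forallP sc; apply/forallP => l.
by rewrite (eqP (sc l)) !inE orbC.
Qed.

(** * Comparison of the quotients [h i] of [theta 'X_i] by ['X_i]; here [d] is the degree of these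
    quotients *)

Section CoefficientQuotients.

Variables (theta : R -> R) (h : 'I_n.+1 -> R) (d : nat).
Hypothesis log_theta : log_derivation A theta.
Hypothesis thetaX : forall i, theta 'X_i = 'X_i * h i.
Hypothesis h_homog : forall i, h i \is d.-homog.

(** For l = a x_i + b x_j one has theta(l) = a x_i (h_i - h_j) + l h_j, so l divides x_i (h_i -
    h_j). It does not divide x_i because b is nonzero. *)
Lemma divides_quotient_diff i j c : c \in A -> i != j -> supported_on i j c ->
  divides (linear_form c) (h i - h j).
Proof.
move=> cA ij sc; have [[lin _] _] := log_theta.
have c0 : c != 0 by have [A0 _] := andP arrA; apply: contraNneq A0 => <-.
have thc : theta (linear_form c) = c 0 i *: ('X_i * (h i - h j)) + linear_form c * h j.
  have thZ a p : theta (a *: p) = a *: theta p.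
    have th0 : theta 0 = 0.
      by have := lin (-1) 0 0; rewrite scaler0 addr0 scaleN1r addNr.
    by have := lin a p 0; rewrite !addr0 th0 addr0.
  rewrite (linear_form_supported_on ij sc) lin thZ !thetaX.
  rewrite mulrBr scalerBr mulrDl -!scalerAl addrA.
  by rewrite subrK.
have := log_derivation_linear_form log_theta cA; rewrite thc => dv.
have ci0 : c 0 i != 0 by have /forallP/(_ i)/eqP-> := sc; rewrite !inE eqxx.
have : divides (linear_form c) ('X_i * (h i - h j)).
  have -> : 'X_i * (h i - h j) = (c 0 i)^-1%:MP *
      (c 0 i *: ('X_i * (h i - h j)) + linear_form c * h j - linear_form c * h j).
    by rewrite addrK mul_mpolyC scalerA mulVf // scale1r.
  by apply/dividesMl/dividesB => //; apply/dividesMr/divides_refl.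
case/(linear_form_prime c0) => //; rewrite -linear_form_delta.
move/divides_linear_form/(hyperplane_subP c0) => [a e].
(* If x_i were a multiple of the form, its zero coefficient at [j] would force the ratio to be 0,
   contradicting the coefficient 1 at [i]. *)
have := congr1 (fun r : 'rV_n.+1 => r 0 j) e; rewrite !mxE eqxx eq_sym (negbTE ij) /=.
move/esym/eqP; rewrite mulf_eq0 => /orP[/eqP a0|]; last first.
  by have /forallP/(_ j)/eqP := sc; rewrite !inE eqxx orbT => /negbTE->.
have := congr1 (fun r : 'rV_n.+1 => r 0 i) e.
by rewrite a0 scale0r !mxE !eqxx => /eqP; rewrite oner_eq0.
Qed.

Lemma quotient_eq2 i j : i != j -> (d < count (supported_on i j) A)%N -> h i = h j.
Proof.
move=> ij dlt; apply/eqP; rewrite -subr_eq0; apply/eqP.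
apply: (@dhomog_divides_eq0 _ _ (filter (supported_on i j) A) d).
- exact: is_arrangement_filter.
- by apply: rpredB; apply: h_homog.
- by rewrite size_filter.
by move=> c; rewrite mem_filter => /andP[sc cA]; apply: divides_quotient_diff.
Qed.

(** Because h_i = h_q, the forms on {j,q} divide h_j - h_i as well. No form is supported on both
    pairs, so the two counts add. *)
Lemma quotient_eq3 i j q : i != j -> j != q -> i != q -> h i = h q ->
  (d < count (supported_on i j) A + count (supported_on j q) A)%N -> h j = h i.
Proof.
move=> ij jq iq hiq dlt; apply/eqP; rewrite -subr_eq0; apply/eqP.
pose P := predU (supported_on i j) (supported_on j q).
apply: (@dhomog_divides_eq0 _ _ (filter P A) d).
- exact: is_arrangement_filter.
- by apply: rpredB; apply: h_homog.
- rewrite size_filter; suff -> : count P A =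
      (count (supported_on i j) A + count (supported_on j q) A)%N by [].
  rewrite -count_predUI -[LHS]addn0; congr (_ + _)%N.
  rewrite (eq_count (a2 := pred0)) ?count_pred0 // => c /=.
  by apply/negP => /andP[si sj]; have := supported_on_disjoint iq ij si sj.
move=> c; rewrite mem_filter => /andP[/orP[sc|sc] cA].
  rewrite -opprB -mulN1r; apply: dividesMl.
  exact: divides_quotient_diff.
by rewrite hiq; apply: divides_quotient_diff.
Qed.

End CoefficientQuotients.

End LogDerivations.

(** * Witnesses and bounds extracted from maxima and minima *)

Section Bounds.

Local Set Implicit Arguments.
Local Unset Strict Implicit.

(** Positivity of [d] rules out the empty maximum, whose value is 0. *)
Lemma leq_bigmaxP (I : finType) (P : pred I) (F : I -> nat) (d : nat) :
  (0 < d)%N -> (d <= \max_(i | P i) F i)%N -> exists2 i, P i & (d <= F i)%N.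
Proof.
case: d => // d _ dF; apply/exists_inP; apply: contraLR dF => /exists_inPn lt.
by rewrite -ltnNge ltnS; apply/bigmax_leqP => i /lt; rewrite -ltnNge.
Qed.

Lemma leq_bigminP (I : eqType) (r : seq I) (F : I -> nat) (x d : nat) :
  (d <= \big[minn/x]_(i <- r) F i)%N ->
  (d <= x)%N /\ forall i, i \in r -> (d <= F i)%N.
Proof.
elim: r => [|a r IH]; first by rewrite big_nil.
rewrite big_cons leq_min => /andP[da /IH[dx dr]]; split=> // i.
by rewrite in_cons => /orP[/eqP-> //|/dr].
Qed.

End Bounds.

(** * Propagation along the tuples of T^{i0,q0} *)

Section IndexTuples.

Local Set Implicit Arguments.
Local Unset Strict Implicit.

Variables (n : nat) (i0 q0 : 'I_n.+1).
Local Notation triple := ('I_n.+1 * 'I_n.+1 * 'I_n.+1)%type.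
Hypothesis i0q0 : (i0 < q0)%N.

(* The entries i0, q0, j_0, ..., j_{n-2} are n+1 distinct indices, so a property
   propagating along the triples reaches every index. *)
Lemma T_ind (P : 'I_n.+1 -> Prop) (v : (n.-1).-tuple triple) :
  (0 < n)%N -> v \in T i0 q0 -> P i0 -> P q0 ->
  (forall i j q, (i, j, q) \in (v : seq triple) -> i != j -> j != q -> i != q ->
     P i -> P q -> P j) ->
  forall x, P x.
Proof.
move=> n0 vT Pi Pq step.
(* [S m] lists the indices reached after [m] triples. It agrees with [indices] only for [m > 0],
   since the empty prefix has no indices while [S 0] already holds [i0] and [q0]. *)
pose S m := i0 :: q0 :: map (@tj n) (take m v).
have inv m : (m <= n.-1)%N ->
    [/\ uniq (S m), forall x, x \in S m -> P x &
        (0 < m)%N -> indices (take m v) =i S m].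
  elim: m => [|m IH] mn.
    rewrite /S take0 /= inE neq_ltn i0q0; split=> // x.
    by rewrite !inE => /orP[]/eqP->.
  have [uS PS iS] := IH (ltnW mn).
  have mv : (m < size v)%N by rewrite size_tuple.
  have := vT; rewrite inE => /forallP/(_ (Ordinal mn)).
  rewrite (tnth_nth (i0, i0, q0)) /=.
  case E: (nth _ _ _) => [[i j] q].
  have takeS : take m.+1 v = rcons (take m v) (i, j, q).
    by rewrite (take_nth (i0, i0, q0)) // E.
  have vin : (i, j, q) \in (v : seq _) by rewrite -E mem_nth.
  move=> cond.
  have [jS iin qin iq] : [/\ j \notin S m, i \in S m, q \in S m & i != q].
    case: (posnP m) cond => /= [m0 /and3P[/eqP-> /eqP-> jn]|m0].
      by rewrite m0 /S take0 /= jn !inE !eqxx orbT neq_ltn i0q0; split.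
    by rewrite !iS // => /and4P[-> iq -> ->]; rewrite neq_ltn iq.
  have Pj : P j.
    apply: (step i j q) => //; try exact: PS.
      by apply: contraNneq jS => <-.
    by apply: contraNneq jS => ->.
  have SE : S m.+1 = rcons (S m) j by rewrite /S takeS map_rcons.
  have SS x : (x \in S m.+1) = (x == j) || (x \in S m) by rewrite SE mem_rcons.
  have uS' : uniq (S m.+1) by rewrite SE rcons_uniq jS.
  split=> [//|x|_ x].
    by rewrite SS => /orP[/eqP->|/PS].
  (* The new triple contributes only [j]: its other two entries are already in [S m], and for
     [m = 0] they are [i0] and [q0] themselves. *)
  rewrite SS takeS /indices map_rcons -cats1 flatten_cat mem_cat /= -/(indices _).
  rewrite -[x \in [:: _; _; _]]/[|| x == i, x == j, x == q | false] orbF.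
  case: (posnP m) cond => /= [m0 /and3P[/eqP-> /eqP-> _]|m0 _].
    rewrite m0 /S take0 /= ?inE.
    by case: (x == i0); case: (x == q0); case: (x == j).
  rewrite iS //; have [|xS] := boolP (x \in S m); first by rewrite orbT.
  rewrite orbF /=; have [xi|_] := eqVneq x i; first by rewrite xi iin in xS.
  by have [xq|_] := eqVneq x q; [rewrite xq qin in xS | rewrite orbF].
have [uS PS _] := inv n.-1 (leqnn _).
have [||_ eS] := uniq_min_size (s2 := enum 'I_n.+1) uS.
- by move=> y _; rewrite mem_enum.
- by rewrite size_enum_ord /S /= size_map size_takel ?size_tuple // prednK.
by move=> x; apply: PS; rewrite eS mem_enum.
Qed.

End IndexTuples.

Theorem theorem4p5 (k : closedFieldType) (hchar : [pchar k] =i pred0)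
    (n : nat) (hn : (2 <= n)%N)
    (s : 'I_n.+1 -> 'I_n.+1 -> nat)
    (hs_pos : forall i j : 'I_n.+1, (i < j)%N -> (1 <= s i j)%N)
    (hs_sym : forall i j : 'I_n.+1, s j i = s i j)
    (A : seq 'rV[k]_n.+1) (hA : complete_hypertetrahedral s A)
    (d : nat) (hd : (1 <= d <= D_max s)%N)
    (theta : {mpoly k[n.+1]} -> {mpoly k[n.+1]}) :
  log_derivation_deg A d theta ->
  exists g : {mpoly k[n.+1]},
    g \is (d.-1).-homog /\ forall p, theta p = g * euler p.
Proof.
move=> [log_theta [t [t_homog thetaE]]].
have [[arrA _] complA _] := hA.
have [d0 dD] := andP hd.
have thetaX i : theta 'X_i = t i.
  rewrite thetaE (bigD1 i) //= big1 => [|j ji].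
    by rewrite addr0 mderivX mnm1E eqxx scale1r -{1}[U_(i)%MM]add0m addmK mpolyX0 mulr1.
  by rewrite mderivX mnm1E eq_sym (negbTE ji) scale0r mulr0.
(* By completeness some form of [A] is a nonzero multiple of ['X_i], and its divisibility property
   gives that ['X_i] divides [t i]. *)
have [h tE] : exists h : 'I_n.+1 -> {mpoly k[n.+1]}, forall i, t i = 'X_i * h i.
  apply: (@fin_all_exists _ _ (fun i q => t i = 'X_i * q)) => i.
  have [c cA hc] := mapP (complA i).
  have [a cE] : exists a, c = a *: delta_mx 0 i.
    apply: hyperplane_subP; last by rewrite -hc.
    by apply/row_neq0P; exists i; rewrite mxE !eqxx oner_neq0.
  have := log_derivation_linear_form arrA log_theta cA.
  have c0 : c != 0 by have [A0 _] := andP arrA; apply: contraNneq A0 => <-.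
  rewrite cE linear_formZ linear_form_delta.
  have a0 : a != 0 by apply: contra_neq c0 => a0; rewrite cE a0 scale0r.
  have thZ p : theta (a *: p) = a *: theta p.
    by rewrite !thetaE scaler_sumr; apply: eq_bigr => j _; rewrite mderivZ scalerAr.
  rewrite thZ thetaX => -[q e]; exists q.
  by rewrite -[t i]scale1r -(mulVf a0) -scalerA e -scalerAr scalerA mulVf // scale1r mulrC.
have h_homog i : h i \is d.-1.-homog.
  by apply: (@dhomog_MXl _ _ _ i); rewrite prednK // -tE.
have thetaXh i : theta 'X_i = 'X_i * h i by rewrite thetaX tE.
(* The three nested maxima in [D_max] yield a pair [i0], [q0] and a tuple [v] whose minimum is at
   least [d]; every element of S_v is then at least [d]. *)
have [i0 _ /(leq_bigmaxP d0)[q0 i0q0 /(leq_bigmaxP d0)[v vT]]] := leq_bigmaxP d0 dD.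
move=> /leq_bigminP[ds dv].
have lt_pred m : (d <= m)%N -> (d.-1 < m)%N by rewrite prednK.
(* The bound on s_{i0,q0} starts the propagation with h_{i0} = h_{q0}; the bound on each later sum
   carries the equality to a new index. *)
have hE i : h i = h i0.
  have i0Nq0 : i0 != q0 by rewrite neq_ltn i0q0.
  apply: (T_ind i0q0 (P := fun x => h x = h i0) _ vT) => //.
  - exact: ltnW.
  - apply/esym/(quotient_eq2 arrA log_theta thetaXh h_homog i0Nq0).
    exact/(leq_trans (lt_pred _ ds))/(supported_on_count_le arrA hs_sym hA).
  - move=> i' j q /dv /lt_pred dlt ij jq iq hi hq; rewrite -[RHS]hi.
    apply: (quotient_eq3 arrA log_theta thetaXh h_homog ij jq iq); first by rewrite hi hq.
    by apply: (leq_trans dlt); apply: leq_add; apply: (supported_on_count_le arrA hs_sym hA).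
exists (h i0); split=> // p; rewrite thetaE /euler mulr_sumr.
by apply: eq_bigr => i _; rewrite tE hE mulrCA mulrA.
Qed.
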